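(* We have $$\inf\{\rho(f) : f \text{ satisfies } (\mathcal{C}^* )\}=\frac12 ,$$ where $f$ ranges over the functions from $\mathbb{N}$ to $\mathbb{R}^{+}$ with $E_0(f)>0$.
   Context: $\mathbb{N}$ denotes the set of non-negative integers. $q$ is a fixed integer greater than or equal to $2$, and $A^{\mathbb{N}}$ is the set of infinite words on the alphabet $A=\{0,1,\dots,q-1\}$. For $w\in A^{\mathbb{N}}$ and $n\in\mathbb{N}$, $L_n(w)$ is the set of words of length $n$ that are factors of $w$ (i.e. occur as blocks of $n$ consecutive letters of $w$), and $p_w(n)=|L_n(w)|$ is the complexity function of $w$. The limit $E(w)=\lim_{n\to\infty}\frac1n\log p_w(n)$ exists. For $f:\mathbb{N}\to\mathbb{R}^{+}$ define $W(f)=\{w\in A^{\mathbb{N}} : p_w(n)\le f(n)\ \text{for all } n\in\mathbb{N}\}$, the limiting lower exponential growth rate $E_0(f)=\liminf_{n\to\infty}\frac1n\log f(n)$, the word entropy $E_W(f)=\sup_{w\in W(f)}E(w)$, and the entropy ratio $\rho(f)=E_W(f)/E_0(f)$. A function $f:\mathbb{N}\to\mathbb{R}^{+}$ satisfies the conditions $(\mathcal{C}^* )$ if: (i) for any $n\in\mathbb{N}$, $f(n+1)>f(n)\ge n+1$; (ii) for any $(n,n')\in\mathbb{N}^2$, $f(n+n')\le f(n)f(n')$.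
   Formalization: The infimum is taken only over f with 0 < E_0(f) ≤ log q; without this bound the claim fails, since f(n) = q^{3n} satisfies (C* ) and has ρ(f) = 1/3 (when E_0(f) > log q, every word lies in W(f)). *)

(* Defs.v *)
From HB Require Import structures.
From mathcomp Require Import all_boot all_order all_algebra.
From mathcomp Require Import all_classical all_reals all_analysis.
Set Implicit Arguments.
Unset Strict Implicit.
Unset Printing Implicit Defensive.
Import Order.TTheory GRing.Theory Num.Theory.
Import numFieldNormedType.Exports.
Local Open Scope classical_set_scope.
Local Open Scope ring_scope.

Definition word (q : nat) : Type := nat -> 'I_q.

Definition factors (q : nat) (w : word q) (n : nat) : {set n.-tuple 'I_q} :=
  [set u : n.-tuple 'I_q |
    `[< exists i : nat, forall k : 'I_n, tnth u k = w (i + k)%N >]]%SET.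

Definition complexity (q : nat) (w : word q) (n : nat) : nat :=
  #|factors w n|.

(* The limit exists for every [w] (Fekete), so [limn] is the actual limit; the
   term at [n = 0] is [0^-1 * _ = 0] and plays no role. *)
Definition entropy (R : realType) (q : nat) (w : word q) : R :=
  limn (fun n : nat => n%:R^-1 * ln ((complexity w n)%:R : R)).

Definition W (R : realType) (q : nat) (f : nat -> R) : set (word q) :=
  [set w | forall n : nat, (complexity w n)%:R <= f n].
Arguments W {R} q f.

(* Real-valued lower limit.  It is the genuine one when the sequence is
   bounded, which [Cstar f] ensures: [1 <= f n <= f 1 ^+ n] for [1 <= n]. *)
Definition E0 (R : realType) (f : nat -> R) : R :=
  limn_inf (fun n : nat => n%:R^-1 * ln (f n)).

(* The set of entropies is bounded by [ln q%:R]; it is nonempty when [Cstar f]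
   holds and [0 < q], since constant words then belong to [W q f]. *)
Definition EW (R : realType) (q : nat) (f : nat -> R) : R :=
  sup [set entropy R w | w in W q f].

Definition rho (R : realType) (q : nat) (f : nat -> R) : R := EW q f / E0 f.

Definition Cstar (R : realType) (f : nat -> R) : Prop :=
  (forall n : nat, f n < f n.+1 /\ n.+1%:R <= f n) /\
  (forall n n' : nat, f (n + n')%N <= f n * f n').

(* The functions over which the infimum is taken, for the alphabet ['I_q].
   The bound [E0 f <= ln q%:R] discards only functions for which the condition
   [p_w <= f] is void: under [Cstar f] one has [f n >= expR (n%:R * E0 f)], so
   [ln q%:R < E0 f] gives [f n >= q%:R ^+ n], [W q f] is the set of all words
   and [rho q f = ln q%:R / E0 f].  These values are arbitrarily small (take
   [f n = q%:R ^+ (k * n)], whose ratio is [k%:R^-1]), so without the bound the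
   infimum would be [0]. *)
Definition admissible (R : realType) (q : nat) : set (nat -> R) :=
  [set f | [/\ forall n : nat, 0 < f n, Cstar f & 0 < E0 f <= ln q%:R]].
Arguments admissible R q : clear implicits.

(* Main.v *)
Require Import Defs.
From HB Require Import structures.
From mathcomp Require Import all_boot all_order all_algebra.
From mathcomp Require Import all_classical all_reals all_analysis.
From mathcomp Require Import zify ring lra.
Import Order.TTheory GRing.Theory Num.Theory.
Import numFieldNormedType.Exports.
Local Open Scope classical_set_scope.
Local Open Scope ring_scope.

Set Implicit Arguments.
Unset Strict Implicit.
Unset Printing Implicit Defensive.

(** By Fekete's lemma, a submultiplicative [f] with [E0 f = E] satisfies
    [f n >= expR (n * E)], so the functions to consider are bounded below by
    [n |-> Num.max (n + 1) (expR (n * E))], which itself satisfies the growth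
    conditions: only the rate [E] matters.

    Lower bound. One needs a word of complexity at most [n + 1] or [expR (n * E)]
    for each [n], with entropy at least [E / 2]. When [expR E >= 2], all the words
    over finitely many letters will do. Otherwise use the binary words in which
    the letters [1] are at distance at least [N]: their number is [n + 1] for
    [n <= N], and their growth rate [lam] solves [lam ^+ N = lam ^+ N.-1 + 1].
    If [mu] is the rate for distance [N + 1], the number of words of length
    [n >= N] for distance [N] is at most [mu ^+ (2 * n)] (lemma
    [sparse_count_le_square]). The least [N] with [mu ^+ 2 <= expR E] thus fits,
    and minimality gives [lam ^+ 2 > expR E]. One infinite word contains all
    these finite words and no other factor (lemma [sparse_universal]).

    Upper bound. Let [E = ln (N + 1) / N], so that the two functions cross at [N],
    with [N] large, and let [w] be allowed by their maximum. If the complexity of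
    [w] is unbounded, it is exactly [n + 1] up to [N], hence a single factor [r]
    of length [N - 1] has two right extensions, and [w] is determined by the
    choices made after the occurrences of [r]. If two occurrences of [r] are at a
    small distance [a], then [r] has period [a], and the successive times when
    this period breaks determine [w]. The gaps between breaks are at least about
    [N]. The crux is that a gap [g] shows up in about [N] distinct factors of
    length slightly above [g], according to its position in the factor (lemma
    [size_gaps_le]), so that the number of gaps up to [g] is at most about
    [expR (E * g) / N], i.e. [(N + 1) ^ x] for [g = (1 + x) N]. With this count,
    the sum of [expR (- s * g)] over all gaps [g] is small as soon as [s] exceeds
    [E / 2] slightly: gaps with [x <= 1] contribute about
    [(N + 1) ^ (x - s / E * (1 + x))], where [x / (1 + x) <= 1 / 2], and larger ones
    a geometric tail. By Kraft's inequality the entropy of [w] is then at most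
    [s]. If on the contrary all occurrences of [r] are far apart, there are too
    few choices for the entropy to be large. *)

(** * Counting factors *)

(** Factors are handled through the positions where they occur: the factors of
    length [n] of [w] are the classes of positions modulo [agree w n], so that
    bounding the complexity amounts to separating, or not, these classes. *)
Definition agree (T : Type) (w : nat -> T) (n i j : nat) : Prop :=
  forall k, (k < n)%N -> w (i + k)%N = w (j + k)%N.

Lemma agree_refl T (w : nat -> T) n i : agree w n i i.
Proof. by []. Qed.

Lemma agree_sym T (w : nat -> T) n i j : agree w n i j -> agree w n j i.
Proof. by move=> h k kn; rewrite h. Qed.

Lemma agree_trans T (w : nat -> T) n j i k :
  agree w n i j -> agree w n j k -> agree w n i k.
Proof. by move=> h1 h2 l ln; rewrite h1 ?h2. Qed.

Lemma agree_shift T (w : nat -> T) n a m i j : (a + m <= n)%N ->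
  agree w n i j -> agree w m (i + a) (j + a).
Proof. by move=> amn h k km; rewrite -!addnA h//; lia. Qed.

Lemma agree_leq T (w : nat -> T) m n i j : (m <= n)%N ->
  agree w n i j -> agree w m i j.
Proof. by move=> mn h k km; rewrite h//; lia. Qed.

Lemma agreeS T (w : nat -> T) n i j :
  agree w n i j -> w (i + n)%N = w (j + n)%N -> agree w n.+1 i j.
Proof. by move=> h e k; rewrite ltnS leq_eqVlt => /predU1P[->//|]; exact: h. Qed.

Definition factor_at (q : nat) (w : word q) (n i : nat) : n.-tuple 'I_q :=
  [tuple w (i + k)%N | k < n].

Lemma factor_at_agree q (w : word q) n i j :
  factor_at w n i = factor_at w n j <-> agree w n i j.
Proof.
split=> [e k kn|h]; last by apply: eq_from_tnth => k; rewrite !tnth_mktuple h.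
by have := congr1 (fun u => tnth u (Ordinal kn)) e; rewrite !tnth_mktuple.
Qed.

Lemma factorsP q (w : word q) n u :
  reflect (exists i, u = factor_at w n i) (u \in factors w n).
Proof.
apply: (iffP idP) => [|[i h]]; rewrite inE.
  move=> /asboolP[i h]; exists i.
  by apply: eq_from_tnth => k; rewrite tnth_mktuple h.
by apply/asboolP; exists i => k; rewrite h tnth_mktuple.
Qed.

Lemma factor_at_in q (w : word q) n i : factor_at w n i \in factors w n.
Proof. by apply/factorsP; exists i. Qed.

Lemma complexity_le_size q (w : word q) n (X : eqType) (s : seq X)
    (phi : nat -> X) :
  (forall i, phi i \in s) ->
  (forall i j, phi i = phi j -> agree w n i j) ->
  (complexity w n <= size s)%N.
Proof.
move=> phis phiP; rewrite /complexity cardE.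
have pos u : u \in factors w n -> exists i, u = factor_at w n i.
  by move/factorsP.
pose g (u : n.-tuple 'I_q) : X := match pselect (u \in factors w n) with
  | left h => phi (projT1 (cid (pos u h)))
  | right _ => phi 0%N end.
have inj : {in enum (factors w n) &, injective g}.
  move=> u v; rewrite !mem_enum /g => uw vw.
  case: pselect => [hu|//]; case: pselect => [hv|//].
  case: cid => i /= ->; case: cid => j /= ->.
  by move=> /phiP /factor_at_agree.
rewrite -(size_map g); apply: uniq_leq_size.
  by rewrite map_inj_in_uniq ?enum_uniq.
move=> _ /mapP[u _ ->]; rewrite /g.
by case: pselect => [h|_]; exact: phis.
Qed.

Lemma size_le_complexity q (w : word q) n (X : eqType) (s : seq X)
    (psi : X -> nat) : uniq s ->
  {in s &, forall x y, agree w n (psi x) (psi y) -> x = y} ->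
  (size s <= complexity w n)%N.
Proof.
move=> us inj; rewrite /complexity cardE -(size_map (factor_at w n \o psi)).
apply: uniq_leq_size.
  rewrite map_inj_in_uniq// => x y xs ys /factor_at_agree; exact: inj.
by move=> _ /mapP[x _ ->]; rewrite mem_enum factor_at_in.
Qed.

Lemma complexity_gt0 q (w : word q) n : (0 < complexity w n)%N.
Proof.
apply: (@size_le_complexity q w n _ [:: tt] (fun=> 0%N)) => //.
by case; case.
Qed.

Lemma complexity_submul q (w : word q) m n :
  (complexity w (m + n) <= complexity w m * complexity w n)%N.
Proof.
rewrite {2 3}/complexity !cardE -(size_allpairs pair).
apply: (@complexity_le_size _ _ _ _ _
  (fun i => (factor_at w m i, factor_at w n (i + m)))) => [i|i j e].
  by apply: allpairs_f; rewrite mem_enum factor_at_in.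
have /factor_at_agree h1 := congr1 fst e.
have /factor_at_agree h2 := congr1 snd e.
move=> k kmn.
have [km|mk] := ltnP k m; first exact: h1.
by have := h2 (k - m)%N; rewrite -!addnA subnKC//; apply; lia.
Qed.

Lemma complexity_le_exp q (w : word q) n : (complexity w n <= q ^ n)%N.
Proof. by rewrite -{2}(card_ord q) -card_tuple; exact: max_card. Qed.

Lemma leq_complexity q (w : word q) m n : (m <= n)%N ->
  (complexity w m <= complexity w n)%N.
Proof.
move=> mn; rewrite {2}/complexity cardE.
apply: (@complexity_le_size _ _ _ _ _ (factor_at w n)) => [i|i j].
  by rewrite mem_enum factor_at_in.
by move=> /factor_at_agree; exact: agree_leq.
Qed.

(** A transversal of the prefix map from factors of length [n.+1] to factors of
    length [n] has at least as many elements as its target, so a set of at most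
    that size on which the map is onto contains one extension of each factor. *)
Lemma extension_unique q (w : word q) n (A : {set n.+1.-tuple 'I_q}) :
  (forall k, exists2 l, factor_at w n.+1 l \in A & agree w n k l) ->
  (#|A| <= complexity w n)%N ->
  forall i j, factor_at w n.+1 i \in A -> factor_at w n.+1 j \in A ->
  agree w n i j -> w (i + n)%N = w (j + n)%N.
Proof.
move=> onto cardA i j iA jA ij.
pose prefix (x : n.+1.-tuple 'I_q) : n.-tuple 'I_q :=
  [tuple tnth x (widen_ord (leqnSn n) k) | k < n].
have prefE k : prefix (factor_at w n.+1 k) = factor_at w n k.
  by apply: eq_from_tnth => l; rewrite !tnth_mktuple.
have sub : factors w n \subset [set prefix x | x in A]%SET.
  apply/fintype.subsetP => _ /factorsP[k ->]; apply/imsetP.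
  have [l lA kl] := onto k; exists (factor_at w n.+1 l) => //.
  by rewrite prefE; apply/factor_at_agree.
have inj : {in A &, injective prefix}.
  apply/imset_injP; rewrite eqn_leq leq_imset_card /=.
  exact: leq_trans (subset_leq_card sub).
suff /factor_at_agree /(_ n (ltnSn n)) :
  factor_at w n.+1 i = factor_at w n.+1 j by [].
by apply: inj => //; rewrite !prefE; apply/factor_at_agree.
Qed.

Lemma stationary_deterministic q (w : word q) n i j :
  (complexity w n.+1 <= complexity w n)%N ->
  agree w n i j -> w (i + n)%N = w (j + n)%N.
Proof.
move=> cw; apply: (@extension_unique _ _ _ (factors w n.+1)) => [k|//||].
- by exists k; rewrite ?factor_at_in.
- exact: factor_at_in.
- exact: factor_at_in.
Qed.

(** Deleting one right extension of a factor that has several keeps the prefix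
    map onto; when the complexity grows by one, what remains has one extension
    per factor. *)
Lemma branching_unique q (w : word q) n i j i' j' :
  (complexity w n.+1 <= (complexity w n).+1)%N ->
  agree w n i j -> w (i + n)%N <> w (j + n)%N ->
  agree w n i' j' -> w (i' + n)%N <> w (j' + n)%N ->
  agree w n.+1 i' j \/ agree w n.+1 j' j.
Proof.
move=> cw ij nij ij' nij'; apply: contrapT => /not_orP[n1 n2].
pose u := factor_at w n.+1 j.
have iu : factor_at w n.+1 i != u.
  by apply/eqP => /factor_at_agree /(_ n (ltnSn n)).
have inS k : ~ agree w n.+1 k j -> factor_at w n.+1 k \in (factors w n.+1 :\ u)%SET.
  by move=> kj; rewrite in_setD1 factor_at_in andbT; apply/eqP => /factor_at_agree.
apply: nij'; apply: (extension_unique _ _ (inS _ n1) (inS _ n2) ij') => [k|].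
- have [/factor_at_agree ku|ku] := eqVneq (factor_at w n.+1 k) u.
    exists i; first by rewrite in_setD1 iu factor_at_in.
    apply: agree_trans (agree_sym ij); exact: agree_leq ku.
  by exists k; rewrite // in_setD1 ku factor_at_in.
- have := cardsD1 u (factors w n.+1); rewrite factor_at_in.
  by move: cw; rewrite /complexity => + e; rewrite e.
Qed.

(** * Growth rates *)

(** Fekete: writing [n] as a multiple of [m] plus a bounded remainder, the ratio
    at [n] is eventually at most the ratio at [m] up to an error in [n^-1]. *)
Lemma fekete (R : realType) (u : nat -> R) :
  (forall n, 0 <= u n) -> (forall m n, u (m + n)%N <= u m + u n) ->
  exists2 l : R, (fun n : nat => n%:R^-1 * u n) @ \oo --> l &
    forall n, (0 < n)%N -> l <= n%:R^-1 * u n.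
Proof.
move=> u0 usub.
pose S := [set (n%:R^-1 * u n : R) | n in [set n | (0 < n)%N]].
have S0 : S !=set0 by exists (1%:R^-1 * u 1%N), 1%N.
have lbS : has_lbound S.
  by exists 0 => _ [n _ <-]; rewrite mulr_ge0// invr_ge0.
have lS n : (0 < n)%N -> inf S <= n%:R^-1 * u n.
  by move=> n0; apply: ge_inf => //; exists n.
exists (inf S) => //.
have umul m k r : u (k * m + r)%N <= k%:R * u m + u r.
  elim: k => [|k IH]; first by rewrite mul0r add0r.
  rewrite mulSn -addnA; apply: le_trans (usub _ _) _.
  by rewrite -addn1 natrD mulrDl mul1r -addrA [X in _ <= _ + X]addrC addrA
    [X in _ <= X]addrC lerD2l.
apply/cvgrPdist_le => e e0.
have [_ [m /= m0 <-] hm] : exists2 x, S x & x < inf S + e / 2.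
  by apply: inf_adherent => //; rewrite divr_gt0.
pose C := \sum_(r < m) u r.
have uC r : (r < m)%N -> u r <= C.
  by move=> rm; rewrite /C (bigD1 (Ordinal rm))//= lerDl sumr_ge0.
near=> n.
have n0 : (0 < n)%N by near: n; exact: nbhs_infty_gt.
have nR : (0 : R) < n%:R by rewrite ltr0n.
have mR : (0 : R) < m%:R by rewrite ltr0n.
rewrite distrC ger0_norm ?subr_ge0 ?lS// lerBlDl.
have h : u n <= (n %/ m)%:R * u m + C.
  by rewrite {1}(divn_eq n m); apply: le_trans (umul _ _ _) _;
    rewrite lerD2l uC// ltn_mod.
have h1 : (n %/ m)%:R * u m <= n%:R * (m%:R^-1 * u m).
  rewrite mulrA ler_wpM2r// ler_pdivlMr// -natrM ler_nat; exact: leq_divM.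
have h2 : n%:R^-1 * u n <= m%:R^-1 * u m + n%:R^-1 * C.
  rewrite -(ler_pM2l nR) mulrDr !mulrA divff ?gt_eqF// !mul1r.
  by rewrite -mulrA; apply: le_trans h _; rewrite lerD2r.
have h3 : n%:R^-1 * C <= e / 2.
  rewrite mulrC ler_pdivrMr// mulrC -ler_pdivrMr ?divr_gt0//.
  by near: n; exact: nbhs_infty_ger.
lra.
Unshelve. all: by end_near. Qed.

Section Entropy.
Context (R : realType) (q : nat).
Implicit Type w : word q.

Lemma entropy_fekete w :
  (fun n : nat => n%:R^-1 * ln ((complexity w n)%:R : R)) @ \oo --> entropy R w
  /\ forall n, (0 < n)%N -> entropy R w <= n%:R^-1 * ln (complexity w n)%:R.
Proof.
have [n|m n|l hl hle] := @fekete R (fun n => ln (complexity w n)%:R).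
- by rewrite ln_ge0// ler1n complexity_gt0.
- rewrite -lnM ?posrE ?ltr0n ?complexity_gt0// ler_ln ?posrE ?ltr0n ?complexity_gt0//.
    by rewrite -natrM ler_nat complexity_submul.
  by rewrite -natrM ltr0n muln_gt0 !complexity_gt0.
have e : entropy R w = l by apply/cvg_lim.
by rewrite e.
Qed.

Lemma entropy_ge w (a : R) : 0 < a ->
  (forall n, a ^+ n <= (complexity w n)%:R) -> ln a <= entropy R w.
Proof.
move=> a0 h; have [+ _] := entropy_fekete w.
move=> /cvg_lim <-//; apply: limr_ge.
  by have [c _] := entropy_fekete w; apply: cvgP c.
near=> n.
have n0 : (0 < n)%N by near: n; exact: nbhs_infty_gt.
rewrite ler_pdivlMl ?ltr0n// mulr_natl -lnXn// ler_ln ?posrE ?exprn_gt0//.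
by rewrite ltr0n complexity_gt0.
Unshelve. all: by end_near. Qed.

(** The limit is also the infimum, so an excess [d] of the entropy over [s] would
    bound the quadratically growing [expR (d * n)] by a linear function of [n]. *)
Lemma entropy_le w (C s : R) :
  (forall n, (complexity w n)%:R <= C * n.+1%:R * expR (s * n%:R)) ->
  entropy R w <= s.
Proof.
move=> h; rewrite leNgt; apply/negP => sE.
have [_ hE] := entropy_fekete w.
set d := entropy R w - s; have d0 : 0 < d by rewrite subr_gt0.
have C0 : 0 < C.
  have := h 0%N; rewrite mulr0 expR0 !mulr1; apply: lt_le_trans.
  by rewrite ltr0n complexity_gt0.
have quad n : (0 < n)%N -> (d * n%:R / 2) ^+ 2 <= C * n.+1%:R.
  move=> n0; apply: (@le_trans _ _ (expR (d * n%:R))); last first.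
    rewrite /d mulrBl expRD expRN ler_pdivrMr ?expR_gt0//.
    apply: le_trans (h n); rewrite -[leRHS]lnK ?posrE ?ltr0n ?complexity_gt0//.
    by rewrite ler_expR mulrC -ler_pdivlMl ?ltr0n// hE.
  have x0 : 0 <= d * n%:R / 2 by rewrite divr_ge0// mulr_ge0// ltW.
  rewrite [in leRHS](splitr (d * n%:R)).
  rewrite expRD -expr2 lerXn2r ?nnegrE ?expR_ge0//.
  by apply: le_trans _ (expR_ge1Dx _); rewrite lerDr.
pose n := (Num.bound (8 * C / d ^+ 2)).+1.
have hn : 8 * C / d ^+ 2 < n%:R.
  apply: (@lt_trans _ _ (Num.bound (8 * C / d ^+ 2))%:R); last by rewrite ltr_nat.
  by apply: archi_boundP; rewrite divr_ge0 ?exprn_ge0 ?mulr_ge0// ltW.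
have n1 : 1 <= n%:R :> R by rewrite ler1n.
have := quad n isT; rewrite leNgt => /negP; apply.
rewrite -natr1; move: hn; rewrite ltr_pdivrMr ?exprn_gt0// => hn.
have : C * (n%:R + 1) <= C * (n%:R + n%:R) by rewrite ler_pM2l// lerD2l.
have : 0 < C * n%:R by rewrite mulr_gt0// ltr0n.
have : 8 * C * n%:R < n%:R * d ^+ 2 * n%:R by rewrite ltr_pM2r// ltr0n.
rewrite (_ : (d * n%:R / 2) ^+ 2 = n%:R * d ^+ 2 * n%:R / 4); last by field.
lra.
Qed.

Lemma entropy_le_ln w : entropy R w <= ln q%:R.
Proof.
apply: (@entropy_le _ 1) => n.
have q0 : (0 < q)%N by case: q w => // w; have [] := w 0%N.
rewrite mul1r expRM_natr lnK ?posrE ?ltr0n//.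
apply: (@le_trans _ _ (q%:R ^+ n)).
  by rewrite -natrX ler_nat complexity_le_exp.
by rewrite ler_peMl ?ler1n// exprn_ge0.
Qed.

Lemma E0_cvg (f : nat -> R) l :
  (fun n : nat => n%:R^-1 * ln (f n)) @ \oo --> l -> E0 f = l.
Proof. by rewrite /E0 => /cvg_limn_inf_sup[]. Qed.

(** Submultiplicativity makes the lower limit an infimum, by Fekete. *)
Lemma Cstar_ge_exp (f : nat -> R) n : Cstar f -> expR (n%:R * E0 f) <= f n.
Proof.
move=> [f1 fM].
have fge1 m : 1 <= f m by apply: le_trans (f1 m).2; rewrite ler1n.
have f0 m : 0 < f m by apply: lt_le_trans (fge1 m).
have [m|m k|l hl hle] := @fekete R (fun n => ln (f n)).
- by rewrite ln_ge0.
- by rewrite -lnM ?posrE// ler_ln ?posrE ?mulr_gt0.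
rewrite (E0_cvg hl); case: n => [|n]; first by rewrite mul0r expR0.
by rewrite -[leRHS]lnK ?posrE// ler_expR -ler_pdivlMl ?ltr0n// hle.
Qed.

End Entropy.

(** * Words with sparse non-zero letters *)

(** Recognizes the words over the first [d] letters in which any two non-zero
    letters are at distance at least [N], the first [k] letters being zero. *)
Fixpoint sparse (q N d k : nat) (u : seq 'I_q) : bool :=
  if u is x :: u' then
    if x == 0%N :> nat then sparse N d k.-1 u'
    else [&& k == 0%N, (x < d)%N & sparse N d N.-1 u']
  else true.

(** Either the first letter is zero, or it is one of [d.-1] others and forces
    [N.-1] zeros after it. *)
Fixpoint sparse_count (N d k n : nat) : nat :=
  if n is n'.+1 then
    if k is k'.+1 then sparse_count N d k' n'
    else (sparse_count N d 0 n' + d.-1 * sparse_count N d N.-1 n')%N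
  else 1%N.

Lemma sparse_countB N d k n : sparse_count N d k n = sparse_count N d 0 (n - k).
Proof.
by elim: n k => [|n IH] [|k] //=; rewrite IH.
Qed.

Lemma sparse_countS N d n : sparse_count N d 0 n.+1 =
  (sparse_count N d 0 n + d.-1 * sparse_count N d 0 (n - N.-1))%N.
Proof. by rewrite /= [in X in (_ + _ * X)%N]sparse_countB. Qed.

Lemma sparseP q N d k (u : seq 'I_q) (o : 'I_q) : o = 0%N :> nat -> (0 < N)%N ->
  sparse N d k u <-> forall i, nth o u i != 0%N :> nat ->
    [/\ (k <= i)%N, (nth o u i < d)%N &
        forall j, (i < j)%N -> nth o u j != 0%N :> nat -> (i + N <= j)%N].
Proof.
move=> o0 N0; elim: u k => [|x u IH] k /=.
  by split=> // _ i; rewrite nth_nil o0.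
have [x0|x0] := eqVneq (x : nat) 0%N.
  split=> [/IH h [|i]|h] /=; first by rewrite x0.
    move=> /h[ki id hi]; split=> //; first by lia.
    by move=> [//|j] /=; rewrite ltnS => ij /(hi _ ij); lia.
  apply/IH => i ui; have [/= ki id hi] := h i.+1 ui; split=> //; first by lia.
  by move=> j ij uj; have := hi j.+1 ij uj; lia.
split=> [/and3P[/eqP-> xd /IH h] [|i] /=|h].
- move=> _; split=> // -[//|j] _ /= /h[]; lia.
- move=> /h[ki id hi]; split=> //.
  by move=> [//|j] /=; rewrite ltnS => ij /(hi _ ij); lia.
- have [k0 xd hx] := h 0%N x0; apply/and3P; split=> //; first by rewrite -leqn0.
  apply/IH => i ui; have [/= ki id hi] := h i.+1 ui; split=> //.
    by have := hx i.+1 isT ui; lia.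
  by move=> j ij uj; have := hi j.+1 ij uj; lia.
Qed.

Lemma card_tuple_cons (T : finType) n (P : pred (seq T)) :
  #|[set u : n.+1.-tuple T | P u]%SET| =
  (\sum_x #|[set v : n.-tuple T | P (x :: v)]%SET|)%N.
Proof.
under eq_bigr do rewrite -sum1_card.
rewrite pair_big_dep -sum1_card /=.
rewrite (reindex (fun p : T * n.-tuple T => [tuple of p.1 :: p.2])) /=; last first.
  exists (fun u : n.+1.-tuple T => (thead u, [tuple of behead u])).
    by move=> [x v] _ /=; rewrite theadE; congr pair; exact: val_inj.
  by move=> u _; rewrite -tuple_eta.
by apply: eq_bigl => p; rewrite !inE.
Qed.

Lemma card_sparse q N d k n : (0 < d <= q)%N ->
  #|[set u : n.-tuple 'I_q | sparse N d k u]%SET| = sparse_count N d k n.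
Proof.
move=> /andP[d0 dq]; have q0 : (0 < q)%N by lia.
elim: n k => [|n IH] k.
  apply/eqP/cards1P; exists [tuple]; apply/finset.setP => u.
  by rewrite !inE tuple0 eqxx.
rewrite card_tuple_cons (bigD1 (Ordinal q0))//= IH.
case: k => [|k] /=; last first.
  rewrite big1 ?addn0// => x x0; apply: eq_card0 => v; rewrite !inE /= ifN//.
congr addn.
rewrite (eq_bigr (fun x : 'I_q =>
  if (x < d)%N then sparse_count N d N.-1 n else 0%N)); last first.
  move=> x x0; rewrite -IH; have {}x0 : (x == 0%N :> nat) = false by apply/negbTE.
  by case: ifP => xd; [apply: eq_card | apply: eq_card0] => v; rewrite !inE /= x0 ?xd.
rewrite -big_mkcondr /= sum_nat_const; congr muln.
have := cardsD1 (Ordinal q0) [set x : 'I_q | (x < d)%N]%SET.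
rewrite inE /= d0 add1n.
have -> : #|[set x : 'I_q | (x < d)%N]%SET| = d.
  have inj : injective (widen_ord dq) by move=> x y /(congr1 val) /= /ord_inj.
  rewrite -[RHS]card_ord -(card_imset _ inj).
  apply: eq_card => x; rewrite inE; apply/idP/imsetP => [xd|[y _ ->]].
    by exists (Ordinal xd) => //; apply: val_inj.
  exact: (ltn_ord y).
move=> e; rewrite [in RHS]e /=; by apply: eq_card => x; rewrite !inE.
Qed.

(** All sparse words are laid out, padded with zeros, in successive dyadic
    intervals; the detour through the 2-adic valuation makes each of them recur
    at arbitrarily large scales, hence once with enough room for the padding. *)
Lemma sparse_universal q N d : (0 < N)%N -> (0 < d <= q)%N ->
  exists w : word q, forall n, complexity w n = sparse_count N d 0 n.
Proof.
move=> N0 dq; have q0 : (0 < q)%N by lia.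
pose o := Ordinal q0.
pose fits t (u : seq 'I_q) := sparse N d 0 u && (size u + N <= 2 ^ t)%N.
pose block t : seq 'I_q :=
  if unpickle (logn 2 t) is Some u then if fits t u then u else [::] else [::].
have blockP t : fits t (block t) \/ block t = [::].
  by rewrite /block; case: unpickle => [u|]; [case: ifP; [left|right]|right].
pose w : word q := fun i => nth o (block (trunc_log 2 i)) (i - 2 ^ trunc_log 2 i).
have wn0 i : w i != 0%N :> nat -> let t := trunc_log 2 i in
    [/\ fits t (block t), (2 ^ t <= i)%N & (i + N < 2 ^ t.+1)%N].
  rewrite /w; set t := trunc_log 2 i => wi /=.
  have [ft|b0] := blockP t; last by rewrite b0 nth_nil in wi.
  have sz : (i - 2 ^ t < size (block t))%N.
    by rewrite ltnNge; apply/negP => /(nth_default o) b0; rewrite b0 in wi.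
  have /andP[_ fs] := ft.
  case: (posnP i) => [i0|i0].
    by move: fs sz; rewrite /t i0 trunc_log0 expn0; lia.
  have /andP[ti _] := trunc_log_bounds (isT : (1 < 2)%N) i0.
  by split=> //; move: ti fs sz; rewrite -/t expnS; lia.
have w_sparse i : w i != 0%N :> nat -> (w i < d)%N /\
    forall j, (i < j)%N -> w j != 0%N :> nat -> (i + N <= j)%N.
  move=> wi; have [/andP[fi _] ti iN] := wn0 _ wi.
  have /(sparseP _ _ _ (erefl : o = 0%N :> nat) N0) h := fi.
  have [_ id hi] := h _ wi; split=> // j ij wj.
  have [_ tj _] := wn0 _ wj.
  (* letters of different intervals are separated by the padding *)
  have [e|ne] := eqVneq (trunc_log 2 i) (trunc_log 2 j); last first.
    have lt : (trunc_log 2 i < trunc_log 2 j)%N.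
      by rewrite ltn_neqAle ne leq_trunc_log// ltnW.
    have : (2 ^ (trunc_log 2 i).+1 <= 2 ^ trunc_log 2 j)%N by rewrite leq_exp2l.
    by lia.
  have := hi (j - 2 ^ trunc_log 2 i)%N; move: wj; rewrite /w -e => wj.
  by move=> /(_ _ wj); lia.
exists w => n; rewrite -(@card_sparse q)//; apply: eq_card => u; rewrite [RHS]inE.
apply/factorsP/idP => [[i ->]|su].
  apply/(sparseP _ _ _ (erefl : o = 0%N :> nat) N0) => k.
  have nthw l : nth o (factor_at w n i) l != 0%N :> nat ->
      nth o (factor_at w n i) l = w (i + l)%N.
    have [ln _|nl] := ltnP l n; last by rewrite nth_default// size_tuple.
    by rewrite -(tnth_nth o (factor_at w n i) (Ordinal ln)) tnth_mktuple.
  move=> kn; move: (kn); rewrite nthw// => /w_sparse[kd hk]; split=> // j kj jn.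
  by move: (jn); rewrite nthw// => /(hk (i + j)%N); lia.
(* the factor 3 ^ (n + N) makes room without changing the 2-adic valuation *)
pose t := (2 ^ pickle (u : seq 'I_q) * 3 ^ (n + N))%N.
have logt : logn 2 t = pickle (u : seq 'I_q).
  by rewrite /t lognM ?expn_gt0// pfactorK// lognX (_ : logn 2 3 = 0%N)// muln0 addn0.
have nt : (n + N <= 2 ^ t)%N.
  apply: leq_trans (ltnW (ltn_expl _ (isT : (1 < 2)%N))).
  apply: leq_trans (ltnW (ltn_expl _ (isT : (1 < 3)%N))) _.
  by rewrite leq_pmull// expn_gt0.
have bt : block t = u.
  by rewrite /block logt pickleK /fits su size_tuple nt.
exists (2 ^ t)%N; apply: eq_from_tnth => k; rewrite tnth_mktuple /w.
have -> : trunc_log 2 (2 ^ t + k) = t.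
  apply: trunc_log_eq => //; rewrite leq_addr /= expnS mul2n -addnn ltn_add2l.
  by have := ltn_ord k; lia.
by rewrite bt addKn (tnth_nth o).
Qed.

(** * Every admissible function has ratio at least one half *)

Lemma bernoulli_ineq (R : realDomainType) (x : R) n :
  0 <= x -> 1 + n%:R * x <= (1 + x) ^+ n.
Proof.
move=> x0; elim: n => [|n IH]; first by rewrite mul0r addr0 expr0.
rewrite exprS -natr1; have n0 : 0 <= n%:R :> R by [].
have : 0 <= n%:R * x * x by rewrite !mulr_ge0.
have : (1 + x) * (1 + n%:R * x) <= (1 + x) * (1 + x) ^+ n.
  by rewrite ler_wpM2l// addr_ge0.
lra.
Qed.

Section Roots.
Context (R : realType).

Lemma sparse_root_exists m : exists x : R, 1 < x /\ x ^+ m * (x - 1) = 1.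
Proof.
pose p : {poly R} := 'X^m * ('X - 1) - 1.
have pE x : p.[x] = x ^+ m * (x - 1) - 1 by rewrite !hornerE.
have [||x /andP[x1 x2]] := @poly_ivt R p 1 2.
- by rewrite ler1n.
- rewrite !pE subrr mulr0 sub0r oppr_le0 ler01 /= subr_ge0.
  by rewrite (_ : 2 - 1 = 1 :> R) ?mulr1 ?exprn_ege1 ?ler1n//; ring.
rewrite /root pE subr_eq0 => /eqP h; exists x; split=> //.
rewrite lt_neqAle x1 andbT; apply/eqP => e.
by move: h; rewrite -e subrr mulr0 => /eqP; rewrite eq_sym oner_eq0.
Qed.

(** The growth rate of binary words whose letters [1] are at distance more than
    [m]. *)
Definition sparse_rate m : R := projT1 (cid (sparse_root_exists m)).

Lemma sparse_rate_gt1 m : 1 < sparse_rate m.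
Proof. by rewrite /sparse_rate; case: cid => x []. Qed.

Lemma sparse_rateE m : sparse_rate m ^+ m * (sparse_rate m - 1) = 1.
Proof. by rewrite /sparse_rate; case: cid => x []. Qed.

Lemma sparse_rate_bernoulli m :
  1 + m%:R * (sparse_rate m - 1) <= sparse_rate m ^+ m.
Proof.
have := @bernoulli_ineq _ (sparse_rate m - 1) m.
by rewrite addrCA subrr addr0; apply; rewrite subr_ge0 ltW// sparse_rate_gt1.
Qed.

(** With [dl = sparse_rate m - 1], Bernoulli's inequality gives
    [dl * (1 + m * dl) <= 1], hence [m * dl ^+ 2 <= 1]. *)
Lemma sparse_rate_small (y : R) : 1 < y -> exists m, sparse_rate m ^+ 2 <= y.
Proof.
move=> y1; pose e := (y - 1) / 3.
have e0 : 0 < e by rewrite divr_gt0// subr_gt0.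
pose m := (Num.bound (e ^- 2)).
have hm : e ^- 2 < m%:R by apply: archi_boundP; rewrite invr_ge0 exprn_ge0// ltW.
exists m; set x := sparse_rate m; set dl := x - 1.
have dl0 : 0 < dl by rewrite subr_gt0 sparse_rate_gt1.
have D1 := sparse_rate_bernoulli m; have D2 := sparse_rateE m.
rewrite -/x -/dl in D1 D2.
have xE : x = 1 + dl by rewrite /dl; ring.
clearbody dl.
have h1 : dl * (1 + m%:R * dl) <= 1.
  by rewrite -[leRHS]D2 mulrC ler_pM2r.
have h2 : 1 < m%:R * e ^+ 2.
  by rewrite -ltr_pdivrMr ?exprn_gt0// mul1r.
have h3 : m%:R * dl ^+ 2 < m%:R * e ^+ 2.
  apply: le_lt_trans h2; apply: le_trans h1.
  by rewrite expr2 mulrDr mulr1 [dl * (_ * _)]mulrCA lerDr ltW.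
have m0 : (0 : R) < m%:R by apply: lt_trans hm; rewrite invr_gt0 exprn_gt0.
have h4 : dl < e.
  by move: h3; rewrite ltr_pM2l// ltr_pXn2r// nnegrE ltW.
have h5 : dl <= 1.
  apply: le_trans h1; rewrite mulrDr mulr1 lerDl.
  by rewrite !mulr_ge0// ltW.
rewrite xE.
have : dl * dl <= dl by rewrite ger_pMr.
have -> : y = 1 + 3 * e by rewrite /e; field.
rewrite expr2; lra.
Qed.

Lemma sparse_count_ge m d (x : R) n : (0 < d)%N -> 1 <= x ->
  x ^+ m * (x - 1) = d%:R - 1 -> x ^+ n <= (sparse_count m.+1 d 0 n)%:R.
Proof.
move=> d0 x1 xE; elim/ltn_ind: n => -[|n] IH; first by rewrite expr0.
rewrite sparse_countS natrD natrM.
have -> : (d.-1)%:R = d%:R - 1 :> R by rewrite -subn1 natrB.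
rewrite -xE; have h1 := IH n (ltnSn n).
have h2 : x ^+ n * (x - 1) <=
    x ^+ m * (x - 1) * (sparse_count m.+1 d 0 (n - m))%:R.
  apply: (@le_trans _ _ (x ^+ m * (x - 1) * x ^+ (n - m))); last first.
    rewrite ler_wpM2l ?IH ?mulr_ge0 ?exprn_ge0 ?subr_ge0//; [lra|lia].
  rewrite mulrAC -exprD ler_wpM2r ?subr_ge0// ler_weXn2l//; lia.
rewrite exprSr; lra.
Qed.

Lemma sparse_count_small m n : (n <= m.+1)%N -> sparse_count m.+1 2 0 n = n.+1.
Proof.
elim: n => [//|n IH] nm; rewrite sparse_countS IH ?(ltnW nm)//.
rewrite (_ : (n - m.+1.-1)%N = 0%N) /=; lia.
Qed.

Lemma sparse_count_mid m k : (k <= m.+1)%N ->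
  (2 * sparse_count m.+1 2 0 (m.+1 + k) = 2 * (m.+1 + k).+1 + k * k.+1)%N.
Proof.
elim: k => [|k IH] km; first by rewrite sparse_count_small; lia.
rewrite addnS sparse_countS (_ : (m.+1 + k - m.+1.-1)%N = k.+1); last by lia.
by rewrite mul1n (@sparse_count_small m k.+1)//; have := IH (ltnW km); lia.
Qed.

(** The heart of the lower bound: with [mu] the rate for distance [m.+2], the
    words for distance [m.+1] number at most [mu ^+ 2] to the [n]. In the first
    window, [D = mu ^+ m.+1 = (mu - 1)^-1] satisfies [D ^+ 2 >= D + m.+1], and
    [mu ^+ (2 * (m.+1 + k)) >= (D + k) ^+ 2] beats the quadratic count; then the
    recurrence propagates. *)
Lemma sparse_count_le_square m n : (m.+1 <= n)%N ->
  (sparse_count m.+1 2 0 n)%:R <= (sparse_rate m.+1 ^+ 2) ^+ n.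
Proof.
set mu := sparse_rate m.+1; set dl := mu - 1; set D := mu ^+ m.+1.
have mu1 : 1 < mu := sparse_rate_gt1 _.
have dl0 : 0 < dl by rewrite subr_gt0.
have Ddl : D * dl = 1 := sparse_rateE _.
have D1 : 1 + m.+1%:R * dl <= D := sparse_rate_bernoulli _.
have muE : mu = 1 + dl by rewrite /dl; ring.
have D0 : 0 < D by rewrite exprn_gt0// (lt_trans _ mu1).
have DE : D = mu ^+ m.+1 by [].
clearbody dl D.
have D2 : D + m.+1%:R <= D * D.
  have : D * (1 + m.+1%:R * dl) <= D * D by rewrite ler_pM2l.
  by rewrite mulrDr mulr1 mulrCA Ddl mulr1.
have D3 : 1 <= D.
  by apply: le_trans D1; rewrite lerDl mulr_ge0// ltW.
have base k : (k <= m.+1)%N ->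
    (sparse_count m.+1 2 0 (m.+1 + k))%:R <= (mu ^+ 2) ^+ (m.+1 + k).
  move=> /sparse_count_mid; set c := sparse_count _ _ _ _; clearbody c => cE.
  have {}cE : 2 * c%:R = 2 * (m.+1%:R + k%:R + 1) + k%:R * (k%:R + 1) :> R.
    by rewrite -[m.+1%:R + _]natrD !natr1 -!natrM -natrD -cE.
  have h : D + k%:R <= mu ^+ (m.+1 + k).
    rewrite exprD -DE; have : D * (1 + k%:R * dl) <= D * mu ^+ k.
      by rewrite ler_pM2l// muE bernoulli_ineq// ltW.
    by rewrite mulrDr mulr1 mulrCA Ddl mulr1.
  rewrite exprAC; apply: (@le_trans _ _ ((D + k%:R) ^+ 2)); last first.
    by rewrite lerXn2r// nnegrE ?addr_ge0 ?exprn_ge0// ltW// (lt_trans _ mu1).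
  have k0 : 0 <= k%:R :> R by [].
  have kk : 0 <= k%:R * k%:R :> R by rewrite mulr_ge0.
  have kD : k%:R <= k%:R * D by rewrite ler_peMr.
  rewrite expr2; move: cE D2; lra.
elim/ltn_ind: n => n IH mn.
have [n2|n2] := leqP n (m.+1 + m.+1).
  by have := base (n - m.+1)%N; rewrite subnKC//; apply; lia.
case: n => // n in IH mn n2 *.
rewrite sparse_countS mul1n natrD.
have h1 := IH n (ltnSn n) _; have h2 := IH (n - m.+1.-1)%N _ _.
apply: le_trans (lerD (h1 _) (h2 _ _)) _; [lia|lia|rewrite /=; lia|].
set j := (n - m.+1.-1)%N.
have -> : n = (m + j)%N by rewrite /j; lia.
have mu0 : 0 < mu by exact: lt_trans mu1.
rewrite -addSn !exprD.
have j0 : 0 < (mu ^+ 2) ^+ j by rewrite !exprn_gt0.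
have m0 : 1 <= mu ^+ m by rewrite exprn_ege1// ltW.
suff : (mu ^+ 2) ^+ m + 1 <= (mu ^+ 2) ^+ m.+1.
  by rewrite -(ler_pM2r j0) mulrDl mul1r.
have : mu ^+ m * 1 <= mu ^+ m * (mu ^+ m * dl * (mu + 1)).
  rewrite ler_pM2l ?(lt_le_trans ltr01)//.
  rewrite [leLHS](_ : 1 = mu ^+ m * dl * mu); last by rewrite -Ddl DE exprSr mulrAC.
  by rewrite ler_wpM2l ?lerDl// mulr_ge0 ?exprn_ge0// ltW.
have -> : (mu ^+ 2) ^+ m.+1 = mu ^+ m * mu ^+ m * (mu * mu).
  by rewrite exprS -exprM mulnC exprM !expr2 mulrC.
have -> : (mu ^+ 2) ^+ m = mu ^+ m * mu ^+ m by rewrite -exprM mulnC exprM expr2.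
have -> : dl = mu - 1 by rewrite muE; ring.
by move: (mu ^+ m) m0 => E E1; lra.
Qed.

(** If [2 <= y], use all the words over [d] letters, [d] being the integral part
    of [y], since [y < d + 1 <= d ^ 2]. Otherwise, take the least [m] such that
    [sparse_rate m ^+ 2 <= y]: by [sparse_count_le_square] the words for distance
    [m] number at most [y ^+ n], and by minimality of [m] the square of their own
    rate, [sparse_rate m.-1], exceeds [y]. *)
Lemma word_half_entropy q (y : R) : 1 < y <= q%:R ->
  exists w : word q, (forall n, (complexity w n <= n.+1)%N \/
    (complexity w n)%:R <= y ^+ n) /\ ln y / 2 <= entropy R w.
Proof.
move=> /andP[y1 yq].
have half (w : word q) (x : R) : 0 < x -> y <= x ^+ 2 ->
    (forall n, x ^+ n <= (complexity w n)%:R) -> ln y / 2 <= entropy R w.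
  move=> x0 yx h; apply: le_trans (entropy_ge x0 h).
  rewrite ler_pdivrMr// mulr_natr -lnXn// ler_ln ?posrE ?exprn_gt0//.
  exact: lt_trans y1.
have [y2|y2] := leP 2 y.
  pose d := Num.truncn y.
  have /andP[dy yd] : d%:R <= y < d.+1%:R by apply: truncn_itv; lra.
  have d2 : (2 <= d)%N by rewrite /d truncn_ge_nat//; lra.
  have dq : (d <= q)%N by rewrite -(ler_nat R); exact: le_trans yq.
  have [w wE] := @sparse_universal q 1 d isT ltac:(lia).
  exists w; split=> [n|].
    right; apply: (@le_trans _ _ (d%:R ^+ n)).
      rewrite wE -natrX ler_nat; elim: n => // n IH.
      by rewrite sparse_countS subn0 expnS; nia.
    by rewrite lerXn2r// nnegrE//; lra.
  apply: (half _ d%:R) => [||n]; first by rewrite ltr0n; lia.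
    by apply: ltW; apply: lt_le_trans yd _; rewrite -natrX ler_nat; nia.
  by rewrite wE; apply: sparse_count_ge; rewrite ?ler1n ?expr0 ?mul1r//; lia.
have ex := sparse_rate_small y1.
case: (ex_minnP ex) => m my mmin.
case: m my mmin => [|m] my mmin.
  have := sparse_rateE 0; rewrite expr0 mul1r => e.
  by move: my; rewrite (_ : sparse_rate 0 = 2); lra.
have q2 : (1 < q)%N by rewrite -(ltr_nat R); exact: lt_le_trans yq.
have [w wE] := @sparse_universal q m.+1 2 isT q2.
exists w; split=> [n|].
  have [nm|nm] := ltnP n m.+1; [left|right]; rewrite wE.
    by rewrite sparse_count_small// ltnW.
  apply: le_trans (sparse_count_le_square nm) _.
  by rewrite lerXn2r// nnegrE ?sqr_ge0//; lra.
apply: (half _ (sparse_rate m)) => [||n].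
- exact: lt_trans (sparse_rate_gt1 m).
- by rewrite ltW// ltNge; apply/negP => /mmin; rewrite ltnn.
- rewrite wE; apply: sparse_count_ge => //; first exact/ltW/sparse_rate_gt1.
  by rewrite sparse_rateE; ring.
Qed.

Lemma rho_ge_half q (f : nat -> R) : (0 < q)%N ->
  f \in admissible R q -> 2^-1 <= rho q f.
Proof.
move=> q0; rewrite inE => -[f0 Cf /andP[E0f Efq]].
have qR : (0 : R) < q%:R by rewrite ltr0n.
have [w [wf wE]] : exists w : word q, (forall n, (complexity w n <= n.+1)%N \/
    (complexity w n)%:R <= expR (E0 f) ^+ n) /\
    ln (expR (E0 f)) / 2 <= entropy R w.
  apply: word_half_entropy; rewrite expR_gt1 E0f /=.
  by rewrite -[leRHS]lnK ?posrE// ler_expR.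
rewrite expRK in wE; rewrite /rho ler_pdivlMr// mulrC.
apply: le_trans wE _; apply: ub_le_sup; last first.
  exists w => // n; case: (wf n) => h.
    by apply: le_trans (Cf.1 n).2; rewrite ler_nat.
  by apply: le_trans h _; rewrite -expRM_natl Cstar_ge_exp.
by exists (ln q%:R) => _ [v _ <-]; exact: entropy_le_ln.
Qed.

End Roots.

(** * Words of complexity n + 1 up to a given length *)

Lemma stationary_bounded q (w : word q) n m :
  (complexity w n.+1 <= complexity w n)%N ->
  (complexity w (n + m) <= complexity w n)%N.
Proof.
move=> cw; rewrite {2}/complexity cardE.
apply: (@complexity_le_size _ _ _ _ _ (factor_at w n)) => [i|i j].
  by rewrite mem_enum factor_at_in.
move=> /factor_at_agree ij; elim: m => [|m IH]; first by rewrite addn0.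
rewrite addnS; apply: agreeS => //.
rewrite [(n + m)%N]addnC !addnA; apply: stationary_deterministic => //.
by apply: agree_shift IH; lia.
Qed.

Section Special.
Context (q : nat) (w : word q) (n i0 a : nat).

(** The occurrences of the factor found at [i0], which will be the one with two
    right extensions. *)
Definition special i := agree w n i i0.

Lemma special_periodic i1 i k : special i1 -> special (i1 + a) ->
  special i -> (k + a < n)%N ->
  w (i + k)%N = w (i + k + a)%N.
Proof.
move=> si1 sia si kan; rewrite (si k); last by lia.
rewrite -(sia k); last by lia.
rewrite -addnA [(a + k)%N]addnC (si1 (k + a)%N)//.
by rewrite -addnA (si (k + a)%N).
Qed.

(** A special factor with two occurrences at distance [a] has period [a], and one
    of its two right extensions continues this period; a break is an occurrence
    followed by the other letter. *)
Definition break i : bool :=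
  `[< special i /\ w (i + n)%N <> w (i + (n - a))%N >].

(** Two breaks at distance at most [n - a] would place the failure of the period that
    ends the first one inside the second special factor. *)
Lemma break_gap_ge i1 i j : (a <= n)%N -> special i1 -> special (i1 + a) ->
  (i < j)%N -> break i -> break j -> (i + n < j + a)%N.
Proof.
move=> an si1 sia ij /asboolP[si ni] /asboolP[sj _]; rewrite ltnNge; apply/negP => jain.
apply: ni; have := @special_periodic i1 j (i + n - a - j) si1 sia sj.
have -> : (j + (i + n - a - j) = i + (n - a))%N by lia.
have -> : (i + (n - a) + a = i + n)%N by lia.
by move=> -> //; lia.
Qed.

End Special.

Section Branching.
Context (q : nat) (w : word q) (n i0 j0 : nat).
Context (cw : (complexity w n.+1 <= (complexity w n).+1)%N)
  (ij0 : agree w n i0 j0) (nij0 : w (i0 + n)%N <> w (j0 + n)%N).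

Local Notation special := (special w n i0).

(** The factor with two right extensions is unique. *)
Lemma branching_special i j :
  agree w n i j -> w (i + n)%N <> w (j + n)%N -> special i /\ special j.
Proof.
move=> ij nij; rewrite /special.
have [h|h] := branching_unique cw ij0 nij0 ij nij.
- have ii : agree w n i i0.
    apply: agree_trans (agree_sym ij0); exact: agree_leq h.
  by split=> //; apply: agree_trans (agree_sym ij) ii.
- have jj : agree w n j i0.
    apply: agree_trans (agree_sym ij0); exact: agree_leq h.
  by split=> //; apply: agree_trans ij jj.
Qed.

Lemma special_two_letters i j l : special i -> special j -> special l ->
  w (i + n)%N <> w (j + n)%N -> w (i + n)%N <> w (l + n)%N ->
  w (j + n)%N = w (l + n)%N.
Proof.
move=> si sj sl nij nil; apply: contrapT => njl.
have sw x y : special x -> special y -> agree w n x y.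
  by move=> sx sy; apply: agree_trans sx (agree_sym sy).
have [h|h] := branching_unique cw (sw _ _ sj si) (nesym nij) (sw _ _ sj sl) njl.
- by apply: nij; rewrite (h n).
- by apply: nil; rewrite (h n).
Qed.

(** When the branching points of [w] are at distance at least [A], a stretch of
    [A] letters involves one binary choice. *)
Lemma complexity_special_far A k :
  (forall i j, (i < j)%N -> special i -> special j -> (i + A <= j)%N) ->
  (complexity w (n + k * A) <= 2 ^ k * complexity w n)%N.
Proof.
move=> far; elim: k => [|k IH]; first by rewrite addn0 mul1n.
rewrite expnS -mulnA; apply: leq_trans (leq_mul (leqnn 2) IH).
rewrite {2}/complexity cardE -[2%N]/(size [:: true; false]) -(size_allpairs pair).
pose bit i := `[< exists2 t, (k * A <= t < k.+1 * A)%N &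
   special (i + t) /\ w (i + t + n)%N = w (i0 + n)%N >].
apply: (@complexity_le_size _ _ _ _ _
  (fun i => (bit i, factor_at w (n + k * A) i))).
  by move=> i; apply: allpairs_f; rewrite ?mem_enum ?factor_at_in//; case: (bit i).
move=> i j e; have eb : bit i = bit j := congr1 fst e.
have {e}/factor_at_agree e := congr1 snd e.
suff h t : (t <= A)%N -> agree w (n + k * A + t) i j.
  by rewrite mulSnr addnA; exact: h.
elim: t => [|t IHt] tA; first by rewrite addn0.
rewrite addnS; apply: agreeS; first exact/IHt/ltnW.
pose s := (k * A + t)%N.
have sA : (k * A <= s < k.+1 * A)%N by rewrite /s mulSn; lia.
have -> : (i + (n + k * A + t) = i + s + n)%N by rewrite /s; lia.
have -> : (j + (n + k * A + t) = j + s + n)%N by rewrite /s; lia.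
apply: contrapT => nij.
have [si sj] : special (i + s) /\ special (j + s).
  apply: branching_special => //.
  by apply: agree_shift (IHt (ltnW tA)); rewrite /s; lia.
have bitE l : special (l + s) -> bit l <-> w (l + s + n)%N = w (i0 + n)%N.
  move=> sl; split=> [/asboolP[t' t'A [st' e']]|e']; last by apply/asboolP; exists s.
  suff -> : s = t' by [].
  have [lt|lt|//] := ltngtP s t'.
  - by have := far (l + s)%N (l + t')%N; rewrite ltn_add2l => /(_ lt sl st'); lia.
  - by have := far (l + t')%N (l + s)%N; rewrite ltn_add2l => /(_ lt st' sl); lia.
have [wi|wi] := eqVneq (w (i + s + n)%N) (w (i0 + n)%N).
  by apply: nij; rewrite wi; apply/esym/bitE => //; rewrite -eb; apply/bitE.
have [wj|wj] := eqVneq (w (j + s + n)%N) (w (i0 + n)%N).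
  by apply: nij; rewrite wj; apply/bitE => //; rewrite eb; apply/bitE.
apply: nij; apply: (special_two_letters _ si sj); first exact: agree_refl.
- by apply/eqP; rewrite eq_sym.
- by apply/eqP; rewrite eq_sym.
Qed.

Section Close.
Context (i1 a : nat).
Context (a0 : (0 < a)%N) (an : (a <= n)%N).
Context (si1 : special i1) (sia : special (i1 + a)).
Local Notation break := (break w n i0 a).

(** Both letters that do not continue the period would be distinct from the one
    that does, found at [i1]: three right extensions. *)
Lemma break_deterministic i j : agree w n i j -> break i = break j ->
  w (i + n)%N = w (j + n)%N.
Proof.
move=> ij e; apply: contrapT => nij.
have [si sj] := branching_special ij nij.
have na : (n - a < n)%N by lia.
have i1E : w (i1 + n)%N = w (i0 + (n - a))%N.
  by rewrite -(sia na) -addnA subnKC.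
have eI : break i <-> w (i + n)%N <> w (i0 + (n - a))%N.
  rewrite -(si _ na); split=> [/asboolP[]//|h]; exact/asboolP.
have eJ : break j <-> w (j + n)%N <> w (i0 + (n - a))%N.
  rewrite -(sj _ na); split=> [/asboolP[]//|h]; exact/asboolP.
have [bi|bi] := boolP (break i).
  have bj : break j by rewrite -e.
  apply: nij; apply: (special_two_letters si1 si sj); rewrite i1E => /esym.
  - exact/eI.
  - exact/eJ.
have wi : w (i + n)%N = w (i0 + (n - a))%N.
  by apply: contrapT => /eI; exact/negP.
have wj : w (j + n)%N = w (i0 + (n - a))%N.
  by apply: contrapT => /eJ; rewrite -e; exact/negP.
by apply: nij; rewrite wi wj.
Qed.

Lemma complexity_breaks m (L : seq (seq bool)) :
  (forall i, mkseq (fun k => break (i + k)) m \in L) ->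
  (complexity w (n + m) <= complexity w n * size L)%N.
Proof.
move=> hL; rewrite {2}/complexity cardE -(size_allpairs pair).
apply: (@complexity_le_size _ _ _ _ _
  (fun i => (factor_at w n i, mkseq (fun k => break (i + k)) m))) => [i|i j e].
  by apply: allpairs_f; rewrite ?mem_enum ?factor_at_in.
have /factor_at_agree ea := congr1 fst e.
have eb k : (k < m)%N -> break (i + k) = break (j + k).
  move=> km; have /= /(congr1 (fun s => nth false s k)) := congr1 snd e.
  by rewrite !nth_mkseq.
suff h t : (t <= m)%N -> agree w (n + t) i j by exact: h.
elim: t => [|t IH] tm; first by rewrite addn0.
rewrite addnS; apply: agreeS; first exact/IH/ltnW.
rewrite [(n + t)%N]addnC !addnA; apply: break_deterministic; last exact: eb.
by apply: agree_shift (IH (ltnW tm)); lia.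
Qed.

End Close.
End Branching.

Definition is_gap (e : nat -> bool) (g : nat) : bool :=
  (0 < g)%N && `[< exists i, [/\ e i, e (i + g)%N &
    forall j, (i < j < i + g)%N -> ~~ e j] >].

Definition gaps (e : nat -> bool) (m : nat) : seq nat :=
  [seq g <- iota 0 m.+1 | is_gap e g].

Lemma gapsP e m g : g \in gaps e m -> [/\ (0 < g)%N, (g <= m)%N &
  exists i, [/\ e i, e (i + g)%N & forall j, (i < j < i + g)%N -> ~~ e j]].
Proof.
by rewrite mem_filter mem_iota ltnS ?add0n => /andP[/andP[g0 /asboolP h] gm].
Qed.

(** Consider the factors of length [m + 2 * A] that start [t < A] letters before
    the last period preceding a break followed by a gap [g]. In such a factor the
    break is the first failure of the period [a], which determines [t], and the
    next break then determines [g]: distinct pairs give distinct factors. *)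
Lemma size_gaps_le q (w : word q) (n i0 i1 a A m : nat) :
  (0 < a <= A)%N -> (A + a <= n)%N ->
  special w n i0 i1 -> special w n i0 (i1 + a) ->
  (size (gaps (break w n i0 a) m) * A <= complexity w (m + 2 * A))%N.
Proof.
move=> /andP[a0 aA] An si1 sia; set e := break w n i0 a.
have an : (a <= n)%N by lia.
pose st g : nat := match pselect (exists i, [/\ e i, e (i + g)%N &
    forall j, (i < j < i + g)%N -> ~~ e j]) with
  | left h => projT1 (cid h) | right _ => 0%N end.
have stP g : g \in gaps e m -> [/\ e (st g), e (st g + g)%N &
    forall j, (st g < j < st g + g)%N -> ~~ e j].
  by move=> /gapsP[_ _ h]; rewrite /st; case: pselect => // h'; case: cid.
pose psi (p : nat * nat) := (st p.1 + n - a - p.2)%N.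
rewrite -[X in (_ * X)%N](size_iota 0 A) -(size_allpairs pair).
apply: (@size_le_complexity _ _ _ _ _ psi).
  apply: allpairs_uniq; rewrite ?filter_uniq ?iota_uniq//.
  by move=> [? ?] [? ?] _ _ [-> ->].
(* if t < t', the break in the first window falls, in the second one, inside the
   special factor, which has period a *)
have same_t g t g' t' : g \in gaps e m -> g' \in gaps e m -> (t < A)%N ->
    (t' < A)%N -> agree w (m + 2 * A) (psi (g, t)) (psi (g', t')) -> (t' <= t)%N.
  move=> gG gG' tA tA' ag; rewrite leqNgt; apply/negP => tt'.
  have [/asboolP[_ ng] _ _] := stP _ gG; apply: ng.
  have [/asboolP[sg' _] _ _] := stP _ gG'.
  have h1 : w (st g + n)%N = w (psi (g', t') + (t + a))%N.
    by rewrite -(ag (t + a)%N); [congr w; rewrite /psi /=; lia|lia].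
  have h2 : w (st g + (n - a))%N = w (psi (g', t') + t)%N.
    by rewrite -(ag t); [congr w; rewrite /psi /=; lia|lia].
  rewrite h1 h2 addnA.
  have := @special_periodic q w n i0 a i1 (st g') (n - a - (t' - t)) si1 sia sg'.
  have -> : (st g' + (n - a - (t' - t)) = psi (g', t') + t)%N by rewrite /psi /=; lia.
  by move=> ->//; lia.
(* the next break in the first window is also one in the second window *)
have same_g g t g' : g \in gaps e m -> g' \in gaps e m -> (t < A)%N ->
    agree w (m + 2 * A) (psi (g, t)) (psi (g', t)) -> (g' <= g)%N.
  move=> gG gG' tA ag; rewrite leqNgt; apply/negP => gg'.
  have [eg egg _] := stP _ gG; have [_ _ /(_ (st g' + g)%N) hg'] := stP _ gG'.
  have [g0 gm _] := gapsP gG.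
  have gn : (n < g + a)%N.
    have := @break_gap_ge q w n i0 a i1 (st g) (st g + g)%N an si1 sia.
    by move=> /(_ _ eg egg); lia.
  have /negP : ~~ e (st g' + g)%N by apply: hg'; lia.
  apply; move: egg => /asboolP[sg ng]; apply/asboolP.
  have {}ag : agree w n.+1 (st g + g) (st g' + g).
    have -> : (st g + g = psi (g, t) + (g + a + t - n))%N by rewrite /psi /=; lia.
    have -> : (st g' + g = psi (g', t) + (g + a + t - n))%N by rewrite /psi /=; lia.
    by apply: agree_shift ag; lia.
  split; first by apply: agree_trans sg; apply: agree_leq (agree_sym ag).
  by rewrite -(ag n)// -(ag (n - a)%N)//; lia.
move=> _ _ /allpairsP[[g t] [/= gG tA ->]] /allpairsP[[g' t'] [/= gG' tA' ->]] ag.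
move: tA tA'; rewrite !mem_iota ?add0n => tA tA'.
have e_t : t = t'.
  apply/eqP; rewrite eqn_leq (same_t _ _ _ _ gG' gG tA' tA (agree_sym ag)).
  exact: same_t ag.
subst t'; congr pair; apply/eqP.
rewrite eqn_leq (same_g _ _ _ gG' gG tA (agree_sym ag)).
exact: same_g ag.
Qed.

(** * Counting binary words with prescribed gaps *)

Lemma mkseq_split T (f : nat -> T) g l :
  mkseq f (g + l) = mkseq f g ++ mkseq (fun k => f (g + k)%N) l.
Proof.
rewrite /mkseq iotaD map_cat add0n; congr cat.
by rewrite -[g in LHS]addn0 iotaDl -map_comp; apply: eq_map.
Qed.

Lemma first_true (e : nat -> bool) i m :
  (forall k, (k < m)%N -> e (i + k)%N = false) \/
  exists t, [/\ (t < m)%N, e (i + t)%N & forall k, (k < t)%N -> e (i + k)%N = false].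
Proof.
have [[t [tm et]]|no] := pselect (exists t, (t < m)%N /\ e (i + t)%N).
  right; have ex : exists t, (t < m)%N && e (i + t)%N by exists t; rewrite tm.
  case: (ex_minnP ex) => s /andP[sm es] smin; exists s; split=> // k ks.
  apply/negbTE/negP => ek; have := smin k; rewrite ek (ltn_trans ks sm) => /(_ isT).
  by rewrite leqNgt ks.
by left=> k km; apply/negbTE/negP => ek; apply: no; exists k.
Qed.

Section Kraft.
Context (R : realType) (e : nat -> bool) (y : R).
Context (y1 : 1 <= y)
  (kraft : forall m, \sum_(g <- gaps e m) y ^- g <= 2^-1).

(** Cutting a window at the second occurrence of [true] gives a renewal
    inequality, which Kraft's inequality solves. *)
Lemma kraft_windows_at m : exists2 L : seq (seq bool),
  (size L)%:R <= 2 * y ^+ m &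
  forall i, e i -> mkseq (fun k => e (i + k)%N) m \in L.
Proof.
have y0 : 0 < y by exact: lt_le_trans y1.
elim/ltn_ind: m => m IH.
have /choice[F FP] : forall k, exists L : seq (seq bool), (k < m)%N ->
    (size L)%:R <= 2 * y ^+ k /\
    forall i, e i -> mkseq (fun l => e (i + l)%N) k \in L.
  move=> k; have [km|mk] := ltnP k m; last by exists [::].
  by have [L h1 h2] := IH k km; exists L.
exists (mkseq (fun k => k == 0%N) m ::
  [seq mkseq (fun k => k == 0%N) g ++ v | g <- gaps e m.-1, v <- F (m - g)%N]).
  rewrite /= size_allpairs_dep -natr1 sumnE big_map natr_sum.
  apply: (@le_trans _ _ (y ^+ m * (2 * 2^-1) + y ^+ m)); last first.
    by rewrite divff// mulr1 -[2]/(1 + 1) mulrDl mul1r.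
  apply: lerD; last by rewrite exprn_ege1.
  apply: (@le_trans _ _ (y ^+ m * (2 * \sum_(g <- gaps e m.-1) y ^- g))); last first.
    by rewrite ler_wpM2l ?ler_pM2l// exprn_ge0// ltW.
  rewrite !mulr_sumr big_seq [leRHS]big_seq; apply: ler_sum => g /gapsP[g0 gm _].
  have [h _] := FP (m - g)%N ltac:(lia).
  apply: le_trans h _; rewrite [leRHS]mulrCA ler_pM2l// expfB_cond ?(gt_eqF y0)//; lia.
move=> i ei; rewrite inE.
have [none|[t [tm et tmin]]] := first_true e i.+1 m.-1.
  apply/orP; left; apply/eqP/eq_in_map => -[|k]; rewrite mem_iota ?addn0//= => km.
  by rewrite -addSnnS none//; lia.
apply/orP; right.
have -> : m = (t.+1 + (m - t.+1))%N by lia.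
rewrite mkseq_split; apply/allpairsPdep.
exists t.+1, (mkseq (fun k => e (i + t.+1 + k)%N) (m - t.+1)); split.
- rewrite mem_filter mem_iota; apply/andP; split; last by lia.
  apply/asboolP; exists i; rewrite -addSnnS; split=> // j /andP[ij jt].
  by have := tmin (j - i.+1)%N; rewrite subnKC// => ->//; lia.
- have [_ ] := FP (m - t.+1)%N ltac:(lia).
  rewrite (_ : (t.+1 + (m - t.+1) - t.+1)%N = (m - t.+1)%N); last by lia.
  by apply; rewrite -addSnnS.
- congr cat; last by apply: eq_map => k; rewrite addnA.
  apply/eq_in_map => -[|k]; rewrite mem_iota ?addn0//= => km.
  by rewrite -addSnnS tmin//; lia.
Qed.

Lemma kraft_windows m : exists2 L : seq (seq bool),
  (size L)%:R <= 2 * m.+1%:R * y ^+ m &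
  forall i, mkseq (fun k => e (i + k)%N) m \in L.
Proof.
have y0 : 0 < y by exact: lt_le_trans y1.
have /choice[F FP] : forall k, exists L : seq (seq bool),
    (size L)%:R <= 2 * y ^+ k /\
    forall i, e i -> mkseq (fun l => e (i + l)%N) k \in L.
  by move=> k; have [L h1 h2] := kraft_windows_at k; exists L.
exists (mkseq (fun=> false) m ::
  [seq mkseq (fun=> false) t ++ v | t <- iota 0 m, v <- F (m - t)%N]).
  rewrite /= size_allpairs_dep -natr1 sumnE big_map natr_sum.
  have h : \sum_(t <- iota 0 m) (size (F (m - t)%N))%:R <= m%:R * (2 * y ^+ m).
    have -> : m%:R * (2 * y ^+ m) = \sum_(t <- iota 0 m) (2 * y ^+ m).
      by rewrite big_const_seq count_predT size_iota iter_addr_0 mulr_natl.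
    rewrite big_seq [leRHS]big_seq; apply: ler_sum => t; rewrite mem_iota => tm.
    apply: le_trans (FP _).1 _; rewrite ler_pM2l// ler_weXn2l//; lia.
  have : 1 <= y ^+ m by rewrite exprn_ege1.
  rewrite -[m.+1%:R]natr1; lra.
move=> i; rewrite inE; have [none|[t [tm et tmin]]] := first_true e i m.
  apply/orP; left; apply/eqP/eq_in_map => k; rewrite mem_iota => km.
  by rewrite none//; lia.
apply/orP; right.
have mE : m = (t + (m - t))%N by lia.
rewrite [in mkseq _ m]mE mkseq_split; apply/allpairsPdep.
exists t, (mkseq (fun k => e (i + t + k)%N) (m - t)); split.
- by rewrite mem_iota; lia.
- by have [_ ] := FP (m - t)%N; apply.
- congr cat; last by apply: eq_map => k; rewrite addnA.
  by apply/eq_in_map => k; rewrite mem_iota => km; rewrite tmin//; lia.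
Qed.

End Kraft.

(** * Functions whose ratio approaches one half *)

(** The element of rank [k] contributes [k ^ (- 1 / 2)], so the sum compares with
    the integral of this power. *)
Lemma sum_inv_sqrt_rank (R : realType) (P : pred nat) m :
  \sum_(g <- [seq g <- iota 0 m | P g])
    (Num.sqrt (size [seq g <- iota 0 g.+1 | P g])%:R)^-1 <=
  2 * Num.sqrt (size [seq g <- iota 0 m | P g])%:R :> R.
Proof.
elim: m => [|m IH]; first by rewrite big_nil mulr_ge0// sqrtr_ge0.
have filtS k : [seq g <- iota 0 k.+1 | P g] =
    [seq g <- iota 0 k | P g] ++ (if P k then [:: k] else [::]).
  by rewrite -addn1 iotaD filter_cat.
rewrite (filtS m); have [Pm|Pm] := ifPn; last by rewrite cats0.
rewrite big_cat big_seq1 filtS Pm size_cat addn1; apply: le_trans (lerD IH (lexx _)) _.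
set c := size _; set x := Num.sqrt c%:R; set y := Num.sqrt c.+1%:R.
have y0 : 0 < y by rewrite sqrtr_gt0 ltr0n.
have x0 : 0 <= x by exact: sqrtr_ge0.
have e : y * y = x * x + 1 by rewrite -!expr2 !sqr_sqrtr// natr1.
have xy : x <= y by rewrite ler_sqrt// ler_nat.
rewrite -(ler_pM2r y0) mulrDl mulVf ?gt_eqF//.
have : 0 <= (y - x) * (y - x) by rewrite mulr_ge0 ?subr_ge0.
lra.
Qed.

Lemma geometric_iota_le (R : realType) (z : R) a l : 0 <= z -> z < 1 ->
  \sum_(g <- iota a l) z ^+ g <= z ^+ a / (1 - z).
Proof.
move=> z0 z1; have z1' : 0 < 1 - z by rewrite subr_gt0.
elim: l a => [|l IH] a; first by rewrite big_nil divr_ge0 ?exprn_ge0// ltW.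
rewrite /= big_cons; apply: le_trans (lerD (lexx _) (IH _)) _.
rewrite exprS (_ : _ + _ = z ^+ a / (1 - z))//; field.
by rewrite gt_eqF.
Qed.

Section Extremal.
Context (R : realType) (N : nat).
Context (N3 : (3 <= N)%N).

(** The growth rate for which the exponential function catches up with
    [n + 1] at [n = N]. *)
Definition crossing_rate : R := ln N.+1%:R / N%:R.

(** The least function satisfying the growth conditions with this rate. *)
Definition crossing (m : nat) : R :=
  Num.max m.+1%:R (expR (crossing_rate * m%:R)).

Local Notation E := crossing_rate.
Let NR : (0 : R) < N%:R. Proof. by rewrite ltr0n; lia. Qed.

Lemma crossing_rateN : E * N%:R = ln N.+1%:R.
Proof. by rewrite /E mulfVK// gt_eqF. Qed.

Lemma crossing_rate_gt0 : 0 < E.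
Proof. by rewrite divr_gt0// ln_gt0// ltr1n; lia. Qed.

Lemma crossing_rateN_ge1 : 1 <= E * N%:R.
Proof.
rewrite crossing_rateN -ler_expR lnK ?posrE ?ltr0n//.
apply: (@le_trans _ _ 4%:R); last by rewrite ler_nat.
have h : expR (2^-1) <= 2 :> R.
  rewrite -[X in expR X]opprK expRN -[leRHS]invrK lef_pV2 ?posrE ?expR_gt0//.
  by apply: le_trans _ (expR_ge1Dx _); lra.
rewrite [X in expR X](_ : 1 = 2^-1 + 2^-1 :> R); last by lra.
rewrite expRD (_ : 4%:R = 2 * 2 :> R); last by ring.
by rewrite ler_pM// expR_ge0.
Qed.

(** Convexity of the exponential function. *)
Lemma crossing_before m : (m <= N)%N -> expR (E * m%:R) <= m.+1%:R.
Proof.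
move=> mN; have t0 : 0 <= m%:R / N%:R :> R by rewrite divr_ge0.
have t1 : m%:R / N%:R <= 1 :> R by rewrite ler_pdivrMr// mul1r ler_nat.
have := @convex_expR R (Itv01 t0 t1) (E * N%:R) 0.
rewrite !convRE /= mulr0 addr0 expR0 mulr1 crossing_rateN lnK ?posrE ?ltr0n//.
rewrite -crossing_rateN mulrCA mulfVK ?gt_eqF// => /le_trans; apply.
rewrite /unstable.onem -[N.+1%:R]natr1 -[m.+1%:R]natr1 mulrDr mulfVK ?gt_eqF//.
lra.
Qed.

Lemma crossing_after m : (N <= m)%N -> m.+1%:R <= expR (E * m%:R).
Proof.
move=> /subnKC <-; elim: (m - N)%N => [|k IH].
  by rewrite addn0 crossing_rateN lnK// posrE ltr0n.
rewrite addnS; set j := (N + k)%N in IH *.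
rewrite -[in expR _]natr1 mulrDr mulr1 expRD.
apply: (@le_trans _ _ (j.+1%:R * (1 + E))); last first.
  by rewrite ler_pM ?expR_ge1Dx// ltW// ltr_wpDl// crossing_rate_gt0.
rewrite -natr1 mulrDr mulr1 lerD2l; apply: le_trans crossing_rateN_ge1 _.
by rewrite mulrC ler_pM2r ?crossing_rate_gt0// ler_nat /j; lia.
Qed.

Lemma crossing_E0 : E0 crossing = E.
Proof.
apply: E0_cvg; apply: (@cvg_trans _ ((fun=> E) @ \oo)); last exact: cvg_cst.
apply: near_eq_cvg; near=> m.
have Nm : (N <= m)%N by near: m; exact: nbhs_infty_ge.
rewrite /crossing max_r ?crossing_after// expRK mulrC mulfK// gt_eqF// ltr0n.
by lia.
Unshelve. all: by end_near. Qed.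

Lemma crossing_admissible q : (2 <= q)%N -> admissible R q crossing.
Proof.
move=> q2; have E0 := crossing_rate_gt0.
have le1 m : m.+1%:R <= crossing m by rewrite le_max lexx.
have le2 m : expR (E * m%:R) <= crossing m by rewrite le_max lexx orbT.
split.
- by move=> m; apply: lt_le_trans (le1 m); rewrite ltr0n.
- split=> [m|m m'].
    split=> //; rewrite gt_max !lt_max ltr_nat ltnS leqnn ltr_expR.
    by rewrite ltr_pM2l// ltr_nat leqnn orbT.
  rewrite ge_max; apply/andP; split.
    apply: (@le_trans _ _ (m.+1%:R * m'.+1%:R)); last by rewrite ler_pM.
    by rewrite -natrM ler_nat; lia.
  by rewrite natrD mulrDr expRD ler_pM ?expR_ge0.
rewrite crossing_E0 E0 /= /E ler_pdivrMr// mulr_natr -lnXn; last by rewrite ltr0n; lia.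
rewrite ler_ln ?posrE ?ltr0n// ?exprn_gt0 ?ltr0n//; [|lia].
rewrite -natrX ler_nat; apply: leq_trans (ltn_expl N (isT : (1 < 2)%N)) _.
by rewrite leq_exp2r//; lia.
Qed.

End Extremal.

(** For [N = K * A], this reads [16 * K <= (N + 1) ^ (1 / K)]. *)
Definition long_enough (K A : nat) : bool := ((16 * K) ^ K <= (K * A).+1)%N.

Lemma length_ge3 K A : (2 <= K)%N -> long_enough K A -> (3 <= K * A)%N.
Proof.
rewrite /long_enough => K2 KA.
have : (16 ^ K <= (K * A).+1)%N by apply: leq_trans KA; rewrite leq_exp2r//; lia.
have : (16 ^ 1 <= 16 ^ K)%N by rewrite leq_exp2l//; lia.
by rewrite expn1; lia.
Qed.

Section UpperBound.
Context (R : realType) (q K A : nat).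
Context (K2 : (2 <= K)%N) (KA : long_enough K A).

Local Notation N := (K * A)%N.
Local Notation E := (crossing_rate R N).
(** The unit of length [A] multiplies the exponential by [X], which is the
    [K]-th root of [N + 1]; the aim is to bound entropies by [s]. *)
Let X : R := expR (E * A%:R).
Let s : R := (2^-1 + 4 / K%:R) * E.
Let y : R := expR s.

Let A0 : (0 < A)%N.
Proof.
move: KA; rewrite /long_enough; case: A => //; rewrite muln0 => h.
have : (2 ^ K <= 1)%N by apply: leq_trans h; rewrite leq_exp2r//; lia.
by have := ltn_expl K (isT : (1 < 2)%N); lia.
Qed.

Let N3 : (3 <= N)%N.
Proof. exact: length_ge3 KA. Qed.

Let AK : (2 * A <= N)%N. Proof. by rewrite leq_pmul2r. Qed.

Let E0 : 0 < E. Proof. exact: crossing_rate_gt0. Qed.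
Let KR : (0 : R) < K%:R. Proof. by rewrite ltr0n; lia. Qed.
Let AR : (0 : R) < A%:R. Proof. by rewrite ltr0n. Qed.
Let NR : (0 : R) < N%:R. Proof. by rewrite ltr0n; lia. Qed.
Let X0 : 0 < X. Proof. exact: expR_gt0. Qed.

Lemma crossing_base_pow : X ^+ K = N.+1%:R.
Proof.
rewrite /X -expRM_natr -mulrA -natrM [(A * K)%N]mulnC (crossing_rateN _ N3) lnK//.
by rewrite posrE ltr0n.
Qed.

Lemma crossing_base_ge : 16 * K%:R <= X.
Proof.
rewrite leNgt; apply/negP => lt.
have : X ^+ K < (16 * K%:R) ^+ K.
  by rewrite ltr_pXn2r ?nnegrE ?(ltW X0) ?mulr_ge0//; lia.
rewrite crossing_base_pow -natrM -natrX ltr_nat ltnNge => /negP; apply; exact: KA.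
Qed.

Lemma crossing_base_ge32 : 32 <= X.
Proof.
apply: le_trans crossing_base_ge; have : 2 <= K%:R :> R by rewrite ler_nat.
lra.
Qed.

Lemma rate_ge_half : E / 2 <= s.
Proof. by rewrite /s mulrDl [E / 2]mulrC lerDl mulr_ge0 ?(ltW E0)// divr_ge0. Qed.

Lemma rate_gt0 : 0 < s.
Proof. by apply: lt_le_trans rate_ge_half; rewrite divr_gt0. Qed.

(** The rank [c] of a gap [g] is at most exponential in [E * g], so the part
    [E / 2] of [s] produces the inverse square root of [c], up to a factor [X];
    the part [4 / K * E] gains [X ^- 2], since [g] is at least [N / 2]. *)
Let gap_term (c g : nat) : (0 < c)%N -> (N <= g + A)%N ->
  (c * A)%:R <= X ^+ 2 * expR (E * g%:R) ->
  y ^- g <= X^-1 * (Num.sqrt A%:R)^-1 * (Num.sqrt c%:R)^-1.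
Proof.
move=> c0 gN h; rewrite -!invfM lef_pV2 ?posrE ?exprn_gt0 ?expR_gt0//; last first.
  by rewrite !mulr_gt0// sqrtr_gt0// ltr0n.
have h1 : Num.sqrt A%:R * Num.sqrt c%:R <= X * expR (E * g%:R / 2).
  have p0 : 0 <= X * expR (E * g%:R / 2) by rewrite mulr_ge0 ?expR_ge0// ltW.
  rewrite -sqrtrM ?ler0n// -natrM mulnC -[leRHS](ger0_norm p0) -sqrtr_sqr.
  rewrite ler_sqrt ?sqr_ge0//; apply: le_trans h _.
  by rewrite exprMn ler_pM2l ?exprn_gt0// expr2 -expRD -splitr.
have h2 : X ^+ 2 <= expR (4 / K%:R * E * g%:R).
  rewrite /X -expRM_natr ler_expR.
  have : N%:R <= 2 * g%:R :> R by rewrite -natrM ler_nat; lia.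
  rewrite natrM -(ler_pM2r (mulr_gt0 E0 KR)) => h3.
  have -> : 4 / K%:R * E * g%:R = 2 * (2 * g%:R * (E * K%:R)) / (K%:R * K%:R).
    by field; rewrite gt_eqF.
  rewrite ler_pdivlMr ?mulr_gt0//; lra.
rewrite -mulrA -expRM_natr.
rewrite (_ : s * g%:R = 4 / K%:R * E * g%:R + E * g%:R / 2); last first.
  by rewrite /s; field; rewrite gt_eqF.
rewrite expRD; apply: (@le_trans _ _ (X ^+ 2 * expR (E * g%:R / 2))).
  by rewrite expr2 -mulrA ler_pM2l.
by rewrite ler_pM2r ?expR_gt0.
Qed.

(** Beyond [2 * N], the geometric series alone is small. *)
Let gap_tail l (P : pred nat) :
  \sum_(g <- [seq g <- iota (2 * N).+1 l | P g]) y ^- g <= 4^-1.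
Proof.
apply: (@le_trans _ _ (\sum_(g <- iota (2 * N).+1 l) y^-1 ^+ g)).
  rewrite big_filter big_mkcond; apply: ler_sum => g _.
  by rewrite exprVn; case: ifP => // _; rewrite invr_ge0 exprn_ge0// expR_ge0.
have y1 : 1 < y by rewrite expR_gt1 rate_gt0.
have y0 : 0 < y by exact: lt_trans y1.
apply: le_trans (geometric_iota_le _ _ _ _) _.
- by rewrite invr_ge0 ltW.
- by rewrite invf_lt1.
rewrite exprS (_ : _ / _ = y^-1 ^+ (2 * N) / (y - 1)); last first.
  by field; rewrite subr_eq0 !gt_eqF.
have yN : y ^+ (2 * N) = N.+1%:R * X ^+ 8.
  rewrite /y -expRM_natr -crossing_base_pow -!expRM_natr -mulrA -natrM -expRD.
  congr expR.
  by rewrite /s !natrM; field; rewrite gt_eqF.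
have y10 : 0 < y - 1 by rewrite subr_gt0.
rewrite exprVn yN -invfM.
have ys : s <= y - 1 by rewrite lerBrDl expR_ge1Dx.
have Ns : 1 <= 2 * N%:R * s.
  apply: le_trans (crossing_rateN_ge1 R N3) _.
  by have := ler_wpM2l (ltW NR) rate_ge_half; lra.
have NS : 0 < N.+1%:R :> R by rewrite ltr0n.
have X1 : 1 <= X by apply: le_trans crossing_base_ge32; rewrite ler1n.
have X8 : 32 <= X ^+ 8.
  by apply: le_trans crossing_base_ge32 _; rewrite exprS ler_peMr ?exprn_ege1// ltW.
rewrite lef_pV2 ?posrE ?mulr_gt0 ?exprn_gt0// mulrAC mulrC.
have h : N%:R * s <= N.+1%:R * (y - 1).
  by rewrite ler_pM ?ler_nat// ltW// rate_gt0.
have : 32 * (N.+1%:R * (y - 1)) <= X ^+ 8 * (N.+1%:R * (y - 1)).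
  by rewrite ler_pM2r// mulr_gt0.
lra.
Qed.

(** The rank of [g] being at most [A^-1 * X ^+ 2 * expR (E * g)], the gaps up to
    [2 * N] contribute at most a constant times [X^-1]: there are at most
    [2 * N + 1] of them, and the inverse square roots of their ranks sum up to
    the square root of their number. *)
Let kraft_gaps (e : nat -> bool) :
  (forall g M, g \in gaps e M -> (N <= g + A)%N /\
    (size (gaps e g) * A)%:R <= X ^+ 2 * expR (E * g%:R)) ->
  forall M, \sum_(g <- gaps e M) y ^- g <= 2^-1.
Proof.
move=> he M.
have yg g : 0 <= y ^- g by rewrite invr_ge0 exprn_ge0// expR_ge0.
apply: (@le_trans _ _ (\sum_(g <- gaps e (2 * N + M)) y ^- g)).
  rewrite /gaps (_ : (2 * N + M).+1 = M.+1 + 2 * N)%N; last by lia.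
  by rewrite iotaD filter_cat big_cat /= lerDl; apply: sumr_ge0.
rewrite /gaps -addSn iotaD filter_cat big_cat /= -/(gaps e (2 * N)).
have -> : 2^-1 = 4^-1 + 4^-1 :> R by lra.
apply: lerD; last exact: gap_tail.
apply: (@le_trans _ _ (\sum_(g <- gaps e (2 * N))
    X^-1 * (Num.sqrt A%:R)^-1 * (Num.sqrt (size (gaps e g))%:R)^-1)).
  rewrite big_seq [leRHS]big_seq; apply: ler_sum => g gG.
  have [gN gc] := he _ _ gG; apply: gap_term => //.
  move: gG; rewrite mem_filter => /andP[gG _].
  rewrite -has_predT; apply/hasP; exists g => //.
  by rewrite mem_filter gG mem_iota; lia.
rewrite -mulr_sumr; apply: le_trans (ler_wpM2l _ (sum_inv_sqrt_rank _ _ _)) _.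
  by rewrite mulr_ge0 ?invr_ge0 ?sqrtr_ge0// ltW.
set c := size _.
have cN : (c <= 3 * K * A)%N.
  rewrite /c size_filter; apply: leq_trans (count_size _ _) _.
  by rewrite size_iota; lia.
have sc : Num.sqrt c%:R <= 2 * K%:R * Num.sqrt A%:R :> R.
  have k0 : 0 <= 2 * K%:R :> R by rewrite mulr_ge0// ltW.
  rewrite -{1}(ger0_norm k0) -sqrtr_sqr -sqrtrM ?sqr_ge0//.
  rewrite -natrM -natrX -natrM.
  by rewrite ler_sqrt ?ler0n// ler_nat; apply: leq_trans cN _; nia.
rewrite -invfM ler_pdivrMl ?mulr_gt0 ?sqrtr_gt0//.
apply: le_trans (ler_wpM2l _ sc) _ => //.
have : 16 * K%:R * Num.sqrt A%:R <= X * Num.sqrt A%:R.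
  by rewrite ler_pM2r ?sqrtr_gt0 ?crossing_base_ge.
lra.
Qed.

Context (w : word q) (w_small : W q (crossing R N) w).

Let w_before m : (m <= N)%N -> (complexity w m <= m.+1)%N.
Proof.
move=> mN; rewrite -(ler_nat R); apply: le_trans (w_small m) _.
by rewrite /crossing max_l// crossing_before.
Qed.

Let w_after m : (N <= m)%N -> (complexity w m)%:R <= expR (E * m%:R).
Proof.
move=> Nm; apply: le_trans (w_small m) _.
by rewrite /crossing max_r// crossing_after.
Qed.

(** After a step where the complexity does not grow, it stays bounded. *)
Let bounded_case m :
  (complexity w m.+1 <= complexity w m)%N -> entropy R w <= s.
Proof.
move=> h; apply: (@entropy_le _ _ _ (complexity w m)%:R) => k.
rewrite -mulrA; apply: (@le_trans _ _ (complexity w m)%:R).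
  rewrite ler_nat; apply: leq_trans (stationary_bounded k h).
  by rewrite leq_complexity// leq_addl.
rewrite ler_peMr// mulr_ege1 ?ler1n//.
by apply: le_trans (expR_ge1Dx _); rewrite lerDl mulr_ge0// ltW// rate_gt0.
Qed.

(** Unless the complexity is bounded, it equals [n + 1] up to [n = N], so there is
    a unique special factor of length [N - 1]. If its occurrences are at distance
    at least [A], the entropy is at most [ln 2 / A]; otherwise its breaks satisfy
    Kraft's inequality at rate [s]. *)
Lemma entropy_crossing_le : entropy R w <= s.
Proof.
have [[m [_ h]]|grow] := pselect (exists m, (m < N)%N /\
    (complexity w m.+1 <= complexity w m)%N); first exact: (@bounded_case m h).
have ge m : (m <= N)%N -> (m.+1 <= complexity w m)%N.
  elim: m => [|m IH] mN; first by rewrite complexity_gt0.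
  rewrite ltnNge; apply/negP => h; apply: grow; exists m; split=> //.
  by apply: leq_trans h _; exact: IH (ltnW mN).
pose n := N.-1; have nN : n.+1 = N by rewrite /n prednK//; lia.
have cw : (complexity w n.+1 <= (complexity w n).+1)%N.
  rewrite nN; apply: leq_trans (w_before (leqnn _)) _.
  by rewrite ltnS -[X in (X <= _)%N]nN; apply: ge; lia.
have [i0 [j0 [ij0 nij0]]] : exists i0 j0,
    agree w n i0 j0 /\ w (i0 + n)%N <> w (j0 + n)%N.
  apply: contrapT => no; apply: grow; exists n; split; first by lia.
  rewrite {2}/complexity cardE.
  apply: (@complexity_le_size _ _ _ _ _ (factor_at w n)) => [i|i j].
    by rewrite mem_enum factor_at_in.
  move=> /factor_at_agree ij; apply: agreeS => //; apply: contrapT => nij.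
  by apply: no; exists i, j.
have [far|close] := pselect (forall i j, (i < j)%N -> special w n i0 i ->
    special w n i0 j -> (i + A <= j)%N).
  apply: (@entropy_le _ _ _ (2 * (complexity w n)%:R)) => k.
  have far_k := complexity_special_far cw ij0 nij0 (k %/ A).+1 far.
  apply: (@le_trans _ _ (2 ^ (k %/ A).+1 * complexity w n)%:R).
    rewrite ler_nat; apply: leq_trans far_k; apply: leq_complexity.
    by have := ltn_ceil k A0; lia.
  have h2 : 2 <= expR (s * A%:R) :> R.
    apply: (@le_trans _ _ (expR (E * A%:R / 2))); last first.
      by rewrite ler_expR mulrAC ler_wpM2r ?rate_ge_half// ltW.
    rewrite leNgt; apply/negP => lt.
    have : expR (E * A%:R / 2) * expR (E * A%:R / 2) < 2 * 2.
      by rewrite ltr_pM// expR_ge0.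
    rewrite -expRD -splitr -/X; move: crossing_base_ge32; lra.
  have h : 2 ^+ (k %/ A) <= expR (s * k%:R) :> R.
    apply: (@le_trans _ _ (expR (s * A%:R) ^+ (k %/ A))).
      by rewrite lerXn2r// nnegrE// expR_ge0.
    rewrite -expRM_natr ler_expR -mulrA ler_pM2l ?rate_gt0// -natrM ler_nat mulnC.
    exact: leq_divM.
  rewrite natrM natrX exprS.
  apply: (@le_trans _ _ (2 * (complexity w n)%:R * expR (s * k%:R))).
    by rewrite mulrAC ler_wpM2l// mulr_ge0.
  by rewrite ler_wpM2r ?expR_ge0// ler_peMr ?mulr_ge0// ler1n.
have [i1 [a [/andP[a0 aA] si1 sia]]] : exists i1 a,
    [/\ (0 < a < A)%N, special w n i0 i1 & special w n i0 (i1 + a)].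
  apply: contrapT => no; apply: close => i j ij si sj.
  rewrite leqNgt; apply/negP => jiA; apply: no; exists i, (j - i)%N.
  by split=> //; [lia|rewrite subnKC// ltnW].
have an : (a <= n)%N by lia.
pose e := break w n i0 a.
have kraft M : \sum_(g <- gaps e M) y ^- g <= 2^-1.
  apply: kraft_gaps => g m gG.
  have gN : (N <= g + A)%N.
    have [g0 _ [i [ei eig _]]] := gapsP gG.
    have ig : (i < i + g)%N by rewrite -[X in (X < _)%N]addn0 ltn_add2l.
    by have := break_gap_ge an si1 sia ig ei eig; lia.
  split=> //.
  apply: (@le_trans _ _ (complexity w (g + 2 * A))%:R).
    by rewrite ler_nat; apply: (size_gaps_le _ _ _ si1 sia) => //; lia.
  apply: le_trans (w_after _) _; first by lia.
  rewrite natrD mulrDr expRD mulrC ler_pM2r ?expR_gt0//.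
  by rewrite natrM [2 * _]mulrC mulrA expRM_natr.
apply: (@entropy_le _ _ _ (2 * (complexity w n)%:R)) => k.
have y1 : 1 <= y by rewrite ltW// expR_gt1 rate_gt0.
have [L sL hL] := kraft_windows y1 kraft k.
apply: (@le_trans _ _ (complexity w n * size L)%:R).
  rewrite ler_nat; apply: leq_trans (complexity_breaks cw ij0 nij0 a0 _ si1 sia hL).
    by rewrite leq_complexity// leq_addl.
  by lia.
rewrite natrM expRM_natr -/y.
have -> : 2 * (complexity w n)%:R * k.+1%:R * y ^+ k =
  (complexity w n)%:R * (2 * k.+1%:R * y ^+ k) by ring.
by rewrite ler_wpM2l.
Qed.

End UpperBound.

(** The rate [E] of [crossing] being [E0], the bound on entropies is a bound on the
    ratio; the error comes from the [K] units of length [A] that make up [N]. *)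
Lemma rho_crossing_le (R : realType) q K A : (2 <= q)%N -> (2 <= K)%N ->
  long_enough K A ->
  rho q (crossing R (K * A)) <= 2^-1 + 4 / K%:R.
Proof.
move=> q2 K2 KA.
have N3 := length_ge3 K2 KA.
have E0 := crossing_rate_gt0 R N3.
rewrite /rho crossing_E0// ler_pdivrMr//.
rewrite /EW; set S := (X in sup X).
have [->|/set0P S0] := eqVneq S set0.
  by rewrite sup0 mulr_ge0 ?(ltW E0)// addr_ge0// ?invr_ge0 ?divr_ge0.
apply: ge_sup => // _ [w Ww <-]; exact: entropy_crossing_le.
Qed.

Theorem theorem2p9 (R : realType) (q : nat) (hq : (2 <= q)%N) :
  inf [set rho q f | f in admissible R q] = 2^-1.
Proof.
have lb : lbound [set rho q f | f in admissible R q] (2^-1 : R).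
  by move=> _ [f fA <-]; apply: rho_ge_half; rewrite ?inE//; lia.
have small K : (2 <= K)%N ->
    inf [set rho q f | f in admissible R q] <= 2^-1 + 4 / K%:R :> R.
  move=> K2; pose A := ((16 * K) ^ K)%N.
  have KA : long_enough K A by rewrite /long_enough leqW// leq_pmull//; lia.
  have N3 := length_ge3 K2 KA.
  apply: le_trans (rho_crossing_le R hq K2 KA).
  apply: ge_inf; first by exists 2^-1.
  by exists (crossing R (K * A)) => //; exact: crossing_admissible.
apply/eqP; rewrite eq_le; apply/andP; split; last first.
  apply: lb_le_inf => //; exists (rho q (crossing R 3)), (crossing R 3) => //.
  exact: crossing_admissible.
apply/ler_addgt0Pr => e e0.
pose K := (Num.bound (4 / e)).+2.
have hK : 4 / e < K%:R.
  apply: (@lt_trans _ _ (Num.bound (4 / e))%:R); last by rewrite ltr_nat.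
  by apply: archi_boundP; rewrite divr_ge0// ltW.
apply: le_trans (small K isT) _; rewrite lerD2l ler_pdivrMr ?ltr0n//.
by move: hK; rewrite ltr_pdivrMr// mulrC => /ltW.
Qed.
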